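(* Quaternary Legendre pairs exist at lengths $\ell = 42, 46, 52, 58, 66, 72, 80$. Explicitly, for each of these $\ell$ the pair $(A_\ell,B_\ell)$ below (digit strings, encoding sequences in $\{\pm1,\pm \mathrm{i}\}^\ell$ by $0\mapsto 1$, $1\mapsto \mathrm{i}$, $2\mapsto -1$, $3\mapsto -\mathrm{i}$; each string is written in consecutive blocks separated by a space which is to be ignored, i.e. the blocks are concatenated) is a quaternary Legendre pair of length $\ell$: $A_{42}=$ \texttt{0200301203231110313222223130111323021030 02}, $B_{42}=$ \texttt{0233320121011303110321230113031101210233 32}; $A_{46}=$ \texttt{3202200013023311120321313123021113320310 002202}, $B_{46}=$ \texttt{0222111332130001013023313320310100031233 111222}; $A_{52}=$ \texttt{0012122022312330100232030101030232001033 213220221210}, $B_{52}=$ \texttt{3201003311331202313322101101101223313202 133113300102}; $A_{58}=$ \texttt{3322100120221122023313002030010030200313 320221122021001223}, $B_{58}=$ \texttt{0212103032123022301010332013111310233010 103220321230301212}; $A_{66}=$ \texttt{2213010031221002233133331030111220221110 30133331332200122130010312}, $B_{66}=$ \texttt{1030320011031331120021213232202020202022 32312120021133130110023030}; $A_{72}=$ \texttt{2301312223030012312201110313100320232320 23001313011102213210030322213103}, $B_{72}=$ \texttt{1003012103130023332202012301112310222220 13211103210202233320031301210300}; $A_{80}=$ \texttt{2310113101113103322022002332033313001212 2212100313330233200220223301311101311013}, $B_{80}=$ \texttt{1032213013300101033321131112303120220231 2132022021303211131123330101003310312230}.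
   Context: Let $\ell$ be an even positive integer and $\mathrm{i}=\sqrt{-1}$. For a complex sequence $X=(X_0,\dots,X_{\ell-1})$, with indices read modulo $\ell$, the periodic autocorrelation at shift $k$ is $\mathrm{PAF}(X,k)=\sum_{j=0}^{\ell-1}X_j\overline{X_{j+k}}$. A quaternary Legendre pair of length $\ell$ is a pair of sequences $A,B\in\{\pm1,\pm \mathrm{i}\}^\ell$ such that $\mathrm{PAF}(A,k)+\mathrm{PAF}(B,k)=-2$ for every $1\le k<\ell$. The digits of a string, read left to right, give the entries with indices $0,1,\dots,\ell-1$. *)

(* Defs.v *)
From Stdlib Require Import Ascii String.
From mathcomp Require Import all_boot all_order all_algebra.
From mathcomp Require Import complex reals.

Set Implicit Arguments.
Unset Strict Implicit.
Unset Printing Implicit Defensive.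

Import GRing.Theory Num.Theory.

Local Open Scope ring_scope.

(* A sequence of length l is a [seq] of size l, with indices 0, ..., l - 1.
   ['i%C] is [Complex 0 1] and [z^*%C] is [conjc z]; without the delimiter the
   same notations denote the generic [Num] imaginary unit and conjugation. *)

(* For j < size X the index j of the first factor is already reduced modulo
   the length, so only j + k is. *)
Definition PAF (R : realType) (X : seq (complex R)) (k : nat) : complex R :=
  \sum_(0 <= j < size X) X`_j * (X`_((j + k) %% size X))^*%C.

Definition quaternary (R : realType) (X : seq (complex R)) : Prop :=
  forall x, x \in X -> x \in [:: 1; -1; 'i%C; - 'i%C].

Record quaternary_legendre_pair (R : realType) (l : nat) (A B : seq (complex R)) :
    Prop := QuaternaryLegendrePair {
  qlp_length_gt0 : (0 < l)%N;
  qlp_length_even : ~~ odd l;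
  qlp_sizel : size A = l;
  qlp_sizer : size B = l;
  qlp_quaternaryl : quaternary A;
  qlp_quaternaryr : quaternary B;
  qlp_PAF : forall k : nat, (1 <= k < l)%N -> PAF A k + PAF B k = -2
}.

Definition digit (R : realType) (c : ascii) : option (complex R) :=
  match c with
  | "0"%char => Some 1
  | "1"%char => Some 'i%C
  | "2"%char => Some (-1)
  | "3"%char => Some (- 'i%C)
  | _ => None
  end.

(* [pmap] drops the [None]s, that is, the spaces between blocks. *)
Definition decode (R : realType) (s : string) : seq (complex R) :=
  pmap (@digit R) (list_ascii_of_string s).

Definition A42 : string :=
  "0200301203231110313222223130111323021030 02"%string.
Definition B42 : string :=
  "0233320121011303110321230113031101210233 32"%string.
Definition A46 : string :=
  "3202200013023311120321313123021113320310 002202"%string.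
Definition B46 : string :=
  "0222111332130001013023313320310100031233 111222"%string.
Definition A52 : string :=
  "0012122022312330100232030101030232001033 213220221210"%string.
Definition B52 : string :=
  "3201003311331202313322101101101223313202 133113300102"%string.
Definition A58 : string :=
  "3322100120221122023313002030010030200313 320221122021001223"%string.
Definition B58 : string :=
  "0212103032123022301010332013111310233010 103220321230301212"%string.
Definition A66 : string :=
  "2213010031221002233133331030111220221110 30133331332200122130010312"%string.
Definition B66 : string :=
  "1030320011031331120021213232202020202022 32312120021133130110023030"%string.
Definition A72 : string :=
  "2301312223030012312201110313100320232320 23001313011102213210030322213103"%string.
Definition B72 : string :=
  "1003012103130023332202012301112310222220 13211103210202233320031301210300"%string.
Definition A80 : string :=
  "2310113101113103322022002332033313001212 2212100313330233200220223301311101311013"%string.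
Definition B80 : string :=
  "1032213013300101033321131112303120220231 2132022021303211131123330101003310312230"%string.

(* Main.v *)
Require Import Defs.
From Stdlib Require Import Ascii String.
From mathcomp Require Import all_boot all_order all_algebra.
From mathcomp Require Import complex reals.
From mathcomp Require Import zify ring.

Import GRing.Theory.

Local Open Scope ring_scope.

(** Write the entries as powers of i and record only the exponents.  Since
    conj(i^f) = i^(3f), every summand of an autocorrelation is again a power of
    i, so PAF(A,k) + PAF(B,k) = -2 follows from a count of exponents modulo 4:
    as many 1s as 3s, and two more 2s than 0s.  These counts are computed. *)

Section PowersOfI.
Variable R : rcfType.
Implicit Type e : nat.

Lemma expi4 : ('i%C : complex R) ^+ 4 = 1.
Proof. by rewrite (exprM _ 2 2) sqr_i sqrrN expr1n. Qed.

Lemma expi_mod e : ('i%C : complex R) ^+ (e %% 4) = 'i%C ^+ e.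
Proof. exact: expr_mod expi4. Qed.

Lemma expi3 : ('i%C : complex R) ^+ 3 = - 'i%C.
Proof. by rewrite exprS sqr_i mulrN1. Qed.

Lemma conjc_expi e : (('i%C : complex R) ^+ e)^*%C = 'i%C ^+ (3 * e).
Proof.
rewrite rmorphXn exprM expi3; congr (_ ^+ e).
by apply/eqP; rewrite eq_complex /= oppr0 !eqxx.
Qed.

Lemma sum_expi (s : seq nat) :
  let n r := count (fun e => (e %% 4)%N == r) s in
  \sum_(e <- s) ('i%C : complex R) ^+ e
    = (n 0)%:R - (n 2)%:R + ((n 1)%:R - (n 3)%:R) * 'i%C.
Proof.
elim: s => [|e s IHs] /=; first by rewrite big_nil !subr0 mul0r addr0.
rewrite big_cons IHs -expi_mod.
have: (e %% 4 < 4)%N by rewrite ltn_mod.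
by case: (e %% 4)%N => [|[|[|[|r]]]] //= _;
  rewrite ?add0n !natrD ?sqr_i ?expi3; ring.
Qed.

End PowersOfI.

(** For [k] up to the length, [rot k a] carries at position j the entry of index j + k modulo the
    length, so the cyclic shift needs no modular indexing. The factor 3 encodes conjugation. *)
Definition lag_exponents (a : seq nat) (k : nat) : seq nat :=
  [seq (p.1 + 3 * p.2)%N | p <- zip a (rot k a)].

(** Only natural numbers and booleans occur here, so evaluation on concrete strings never meets the
    abstract field [R]. *)
Definition legendre_exponents (l : nat) (a b : seq nat) : bool :=
  [&& (0 < l)%N, ~~ odd l, size a == l, size b == l &
    all (fun k =>
           let s := lag_exponents a k ++ lag_exponents b k in
           let n r := count (fun e => (e %% 4)%N == r) s in
           (n 2 == n 0 + 2)%N && (n 1 == n 3))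
        (iota 1 l.-1)].

Definition digit_exponent (c : ascii) : option nat :=
  match c with
  | "0"%char => Some 0%N
  | "1"%char => Some 1%N
  | "2"%char => Some 2%N
  | "3"%char => Some 3%N
  | _ => None
  end.

Definition decode_exponents (s : string) : seq nat :=
  pmap digit_exponent (list_ascii_of_string s).

Section Sequences.
Variable R : realType.
Local Notation expi := (GRing.exp ('i%C : complex R)).

Lemma decodeE (s : string) : decode R s = map expi (decode_exponents s).
Proof.
have digitE c : digit R c = omap expi (digit_exponent c).
  (* A character consists of eight bits, so this is a check of all 256 characters. *)
  by case: c => [] [] [] [] [] [] [] [] [] //=; rewrite ?sqr_i ?expi3.
rewrite /decode /decode_exponents.
elim: (list_ascii_of_string s) => //= c t IHt.
by rewrite digitE; case: (digit_exponent c) => //= e; rewrite IHt.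
Qed.

Lemma quaternary_expi (a : seq nat) : quaternary (map expi a).
Proof.
move=> _ /mapP[e _ ->]; rewrite -expi_mod !inE.
have: (e %% 4 < 4)%N by rewrite ltn_mod.
by case: (e %% 4)%N => [|[|[|[|r]]]] //= _;
  rewrite ?expr0 ?expr1 ?sqr_i ?expi3 eqxx ?orbT.
Qed.

(** The bound on [k] is what makes [rot k a] the cyclic shift by [k]: beyond the length, [rot] is
    the identity. *)
Lemma PAF_expi (a : seq nat) (k : nat) : (k <= size a)%N ->
  PAF (map expi a) k = \sum_(e <- lag_exponents a k) expi e.
Proof.
move=> le_k; rewrite /PAF size_map big_map.
have size_zip_rot : size (zip a (rot k a)) = size a.
  by rewrite size_zip size_rot minnn.
(* Both sums are indexed by positions; [big_seq] keeps the bound [j < size a], under which the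
   default values are never reached. *)
rewrite (big_nth (0, 0)%N) size_zip_rot big_seq [RHS]big_seq.
apply: eq_bigr => j; rewrite mem_index_iota => /andP[_ lt_j].
rewrite nth_zip ?size_rot //= exprD -conjc_expi (nth_map 0%N) //.
rewrite (nth_map 0%N) ?ltn_pmod ?(leq_ltn_trans _ lt_j) //.
congr (_ * (expi _)^*%C); rewrite /rot nth_cat size_drop nth_drop.
(* Either [j + k] does not wrap around and the entry lies in the dropped tail of [a], or it lies in
   the prefix of length [k] moved to the end. *)
rewrite ltn_subRL (addnC k j); case: ltnP => [lt_jk|le_jk].
  by rewrite modn_small // addnC.
have le_sub : (j + k - size a < k)%N by lia.
have -> : (j - (size a - k) = j + k - size a)%N by lia.
(* One subtraction of the length completes the reduction, as [j + k - size a < k <= size a]. *)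
rewrite nth_take // -{1}(subnK le_jk) modnDr modn_small //.
exact: leq_trans le_sub le_k.
Qed.

Lemma legendre_exponentsP (l : nat) (a b : seq nat) :
  legendre_exponents l a b ->
  quaternary_legendre_pair l (map expi a) (map expi b).
Proof.
case/and5P=> l_gt0 l_even /eqP sza /eqP szb /allP countP.
split; rewrite ?size_map //; try exact: quaternary_expi.
move=> k /andP[k_gt0 lt_k].
have le_k : (k <= l)%N by exact: ltnW.
rewrite !PAF_expi ?sza ?szb // -big_cat sum_expi.
(* The range stops before 1 + [l.-1], which equals [l] because [l] is positive. *)
have /countP/= : k \in iota 1 l.-1 by rewrite mem_iota k_gt0 add1n prednK.
case/andP=> /eqP -> /eqP ->.
by rewrite subrr mul0r addr0 natrD opprD addNKr.
Qed.

Lemma decode_legendre (l : nat) (s t : string) :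
  legendre_exponents l (decode_exponents s) (decode_exponents t) ->
  quaternary_legendre_pair l (decode R s) (decode R t).
Proof. by rewrite !decodeE; apply: legendre_exponentsP. Qed.

End Sequences.

Theorem theorem1 (R : realType) :
  (forall l : nat, l \in [:: 42; 46; 52; 58; 66; 72; 80]%N ->
     exists A B : seq (complex R), quaternary_legendre_pair l A B) /\
  quaternary_legendre_pair 42 (decode R A42) (decode R B42) /\
  quaternary_legendre_pair 46 (decode R A46) (decode R B46) /\
  quaternary_legendre_pair 52 (decode R A52) (decode R B52) /\
  quaternary_legendre_pair 58 (decode R A58) (decode R B58) /\
  quaternary_legendre_pair 66 (decode R A66) (decode R B66) /\
  quaternary_legendre_pair 72 (decode R A72) (decode R B72) /\
  quaternary_legendre_pair 80 (decode R A80) (decode R B80).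
Proof.
have H42 : quaternary_legendre_pair 42 (decode R A42) (decode R B42).
  by apply: decode_legendre; vm_compute.
have H46 : quaternary_legendre_pair 46 (decode R A46) (decode R B46).
  by apply: decode_legendre; vm_compute.
have H52 : quaternary_legendre_pair 52 (decode R A52) (decode R B52).
  by apply: decode_legendre; vm_compute.
have H58 : quaternary_legendre_pair 58 (decode R A58) (decode R B58).
  by apply: decode_legendre; vm_compute.
have H66 : quaternary_legendre_pair 66 (decode R A66) (decode R B66).
  by apply: decode_legendre; vm_compute.
have H72 : quaternary_legendre_pair 72 (decode R A72) (decode R B72).
  by apply: decode_legendre; vm_compute.
have H80 : quaternary_legendre_pair 80 (decode R A80) (decode R B80).
  by apply: decode_legendre; vm_compute.
do 7?split=> //; move=> l; rewrite !inE.
(* The witnesses are left open and filled by the explicit pair whose length matches. *)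
by do 6?[case/orP]; move/eqP->; do 2!eexists; eassumption.
Qed.
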